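(* Let $\mathcal{L}$ be a complete modular lattice and let $\mathfrak{m}$ be a submonoid with zero of $\mathrm{End}_{lin}(\mathcal{L})$ that is closed under complements. If $\mathcal{L}$ is $\mathfrak{m}$-$\mathcal{K}$-extending and satisfies $\mathfrak{m}$-$C_2$, then $\mathfrak{m}/\equiv_\Delta$ is a regular monoid.
   Context: $\mathbf{0},\mathbf{1}$ denote the least and greatest elements; $[a,b]=\{x: a\le x\le b\}$. An element $x$ ''is a complement'' (or ''has a complement'') if there is $x'$ with $x\wedge x'=\mathbf{0}$, $x\vee x'=\mathbf{1}$; $C(\mathcal{L})$ is the set of such elements. An element $x$ of a bounded lattice is essential if $x\wedge y=\mathbf{0}$ implies $y=\mathbf{0}$. Linear morphism: a map $\varphi:\mathcal{L}\to\mathcal{L}'$ between bounded lattices is linear if there exist $\ker_\varphi\in\mathcal{L}$ (the kernel) and $a'\in\mathcal{L}'$ such that (1) $\varphi(x)=\varphi(x\vee\ker_\varphi)$ for all $x$; (2) $\varphi$ restricts to a lattice isomorphism $[\ker_\varphi,\mathbf{1}]\to[\mathbf{0},a']$ (so $a'=\varphi(\mathbf{1})$). $\mathrm{End}_{lin}(\mathcal{L})$ is the monoid of linear morphisms $\mathcal{L}\to\mathcal{L}$ under composition; its zero is the constant map $\mathbf{0}$. A submonoid with zero contains the identity and the zero morphism. For $x$ with complement $x'$, the projection $\pi_x$ (with respect to $x'$) is $\pi_x(a)=(a\vee x')\wedge x$, viewed with codomain $\mathcal{L}$ or $[\mathbf{0},x]$; $\iota_x:[\mathbf{0},x]\to\mathcal{L}$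 is the inclusion. $\mathfrak{m}$ is closed under complements if for every $\varphi\in\mathfrak{m}$ and all $x,y\in C(\mathcal{L})$ such that $\varphi$ restricts to an isomorphism $\varphi|_x:[\mathbf{0},x]\to[\mathbf{0},y]$, one has $\iota_x(\varphi|_x)^{-1}\pi_y\in\mathfrak{m}$ (for every choice of complement of $y$ defining $\pi_y$). $\mathcal{L}$ is $\mathfrak{m}$-$\mathcal{K}$-extending if for every $\varphi\in\mathfrak{m}$ there is $c\in C(\mathcal{L})$ such that $\ker_\varphi$ is essential in $[\mathbf{0},c]$ (in particular $\ker_\varphi\le c$). $\mathfrak{m}$-$C_2$: whenever $a,x,x'\in\mathcal{L}$, $x'$ is a complement of $x$, $\theta:[\mathbf{0},x]\to[\mathbf{0},a]$ is an isomorphism and $\iota_a\theta\pi_x\in\mathfrak{m}$ ($\pi_x$ with respect to $x'$), then $a$ is a complement in $\mathcal{L}$. For $\varphi,\psi\in\mathfrak{m}$, $\varphi\equiv_\Delta\psi$ means: there is an essential element $x$ of $\mathcal{L}$ such that $\varphi(y)=\psi(y)$ for all $y\le x$. This is a congruence on $\mathfrak{m}$, and $\mathfrak{m}/\equiv_\Delta$ is the quotient monoid. A monoid $E$ is regular if for every $e\in E$ there is $f\in E$ with $e=efe$. *)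

(* Defs.v *)
From HB Require Import structures.
From mathcomp Require Import all_boot all_order.
From mathcomp Require Import boolp classical_sets functions.

Set Implicit Arguments.
Unset Strict Implicit.
Unset Printing Implicit Defensive.

Import Order.TTheory.
Local Open Scope order_scope.

HB.mixin Record Lattice_isModular (d : Order.disp_t) (L : Type)
    of Order.Lattice d L := {
  modularL : forall x y z : L,
    x <= z -> x `|` (y `&` z) = (x `|` y) `&` z
}.

#[short(type="tbModularLatticeType")]
HB.structure Definition TBModularLattice (d : Order.disp_t) :=
  { L of Lattice_isModular d L & Order.TBLattice d L }.

HB.mixin Record POrder_isComplete (d : Order.disp_t) (L : Type)
    of Order.POrder d L := {
  has_supremum : forall A : set L, exists s : L, supremums A s;
  has_infimum : forall A : set L, exists s : L, infimums A s
}.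

#[short(type="completeModularLatticeType")]
HB.structure Definition CompleteModularLattice (d : Order.disp_t) :=
  { L of POrder_isComplete d L & TBModularLattice d L }.

Section BoundedLattices.
Context (d : Order.disp_t) (L : tbLatticeType d).
Implicit Types x y a c : L.

Definition is_complement x x' := x `&` x' = \bot /\ x `|` x' = \top.

Definition has_complement x := exists x', is_complement x x'.

Definition essential x := forall y, x `&` y = \bot -> y = \bot.

(* x is an essential element of the bounded lattice [\bot, c] *)
Definition essential_in c x :=
  x <= c /\ forall y, y <= c -> x `&` y = \bot -> y = \bot.

Definition proj x x' a := (a `|` x') `&` x.

End BoundedLattices.

Section ClosedIntervals.
Context (d : Order.disp_t) (L : porderType d).
Implicit Types a b x : L.

Definition itvcc a b : set L := [set x | a <= x <= b]%classic.

Lemma mem_itvcc a b x : (x \in itvcc a b) = (a <= x <= b).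
Proof. by apply/idP/idP => [/set_mem|h]; last apply/mem_set. Qed.

Lemma itvccE a b x : itvcc a b x = (a <= x <= b) :> Prop.
Proof. by []. Qed.

End ClosedIntervals.

(* f restricts to a lattice isomorphism from the sublattice A to the
   sublattice B; the values of f outside A are irrelevant. *)
Definition lattice_iso (d d' : Order.disp_t) (L : latticeType d)
    (L' : latticeType d') (A : set L) (B : set L') (f : L -> L') :=
  [/\ set_bij A B f,
      {in A &, {morph f : x y / x `&` y >-> x `&` y}} &
      {in A &, {morph f : x y / x `|` y >-> x `|` y}}].

Definition is_kernel (d d' : Order.disp_t) (L : tbLatticeType d)
    (L' : tbLatticeType d') (f : L -> L') (k : L) :=
  (forall x, f x = f (x `|` k)) /\
  exists a', lattice_iso (itvcc k \top) (itvcc \bot a') f.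

Definition is_linear (d d' : Order.disp_t) (L : tbLatticeType d)
    (L' : tbLatticeType d') (f : L -> L') := exists k, is_kernel f k.

Section KernelTheory.
Context (d d' : Order.disp_t) (L : tbLatticeType d) (L' : tbLatticeType d').
Variables (f : L -> L') (k : L).
Hypothesis fk : is_kernel f k.

Let in_up x : k <= x -> x \in itvcc k \top.
Proof. by move=> kx; rewrite mem_itvcc kx lex1. Qed.

Lemma is_kernelE x : f x = f (x `|` k). Proof. by case: fk. Qed.

Lemma kernelI x y : k <= x -> k <= y -> f (x `&` y) = f x `&` f y.
Proof. by case: fk => _ [a' [_ fI _]] kx ky; apply: fI; apply: in_up. Qed.

Lemma kernelU x y : f (x `|` y) = f x `|` f y.
Proof.
rewrite is_kernelE (is_kernelE x) (is_kernelE y).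
case: fk => _ [a' [_ _ fU]].
by rewrite -fU ?in_up ?leUr // joinACA joinxx.
Qed.

Lemma kernel_mono x y : x <= y -> f x <= f y.
Proof. by move=> xy; apply/join_idPl; rewrite -kernelU (join_idPl xy). Qed.

Lemma kernel_inj x y : k <= x -> k <= y -> f x = f y -> x = y.
Proof.
case: fk => _ [a' [[_ fi _] _ _]] kx ky; apply: fi; exact: in_up.
Qed.

Lemma kernel_surj z : z <= f \top -> exists2 x, k <= x & f x = z.
Proof.
case: fk => _ [a' [[ff _ fs] _ _]] zt.
have ta : f \top <= a'.
  have /= := ff \top; rewrite !itvccE !lex1 => /(_ isT).
  by case/andP.
have := fs z; rewrite itvccE le0x (le_trans zt ta) => /(_ isT).
by case=> x; rewrite itvccE => /andP[kx _] <-; exists x.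
Qed.

Lemma kernel0 : f k = \bot.
Proof.
have [x kx fx0] := kernel_surj (le0x _).
by apply/eqP; rewrite -lex0 -fx0 kernel_mono.
Qed.

Lemma kernel_le x y : k <= y -> f x <= f y -> x <= y.
Proof.
move=> ky fxy; suff <- : x `|` y = y by apply: leUl.
apply: kernel_inj => //; first by rewrite (le_trans ky) ?leUr.
by rewrite kernelU; apply/join_idPr.
Qed.

Lemma kernel_uniq k' : is_kernel f k' -> k' = k.
Proof.
move=> fk'; have fk'0 : f k' = \bot.
  case: fk' => _ [a' [[_ _ fs] fI _]].
  have [x xk fx0] : ((f @` itvcc k' \top) \bot)%classic.
    by apply: fs; rewrite itvccE lexx le0x.
  move: (xk); rewrite itvccE => /andP[k'x _].
  by apply/eqP; rewrite -lex0 -fx0 kernel_mono.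
apply/eqP; rewrite eq_le; apply/andP; split.
  by apply: kernel_le => //; rewrite fk'0 le0x.
suff <- : k `|` k' = k' by apply: leUl.
case: fk' => fk'E [a' [[_ fi _] _ _]].
apply: fi; rewrite ?mem_itvcc ?lexx ?leUr ?lex1 //.
by rewrite -fk'E kernel0 fk'0.
Qed.

End KernelTheory.

Section LinearEndomorphisms.
Context (d : Order.disp_t) (L : tbLatticeType d).

Record lin_end := LinEnd { lin_fun :> L -> L; _ : `[< is_linear lin_fun >] }.

HB.instance Definition _ := [isSub for lin_fun].
HB.instance Definition _ := [Choice of lin_end by <:].

Lemma lin_endP (f : lin_end) : is_linear f.
Proof. by apply/asboolP; case: f. Qed.

(* The kernel is unique by kernel_uniq, so the choice is harmless. *)
Definition ker (f : lin_end) : L := sval (cid (lin_endP f)).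

Lemma kerP (f : lin_end) : is_kernel f (ker f).
Proof. by rewrite /ker; case: cid. Qed.

Lemma is_linear_id : is_linear (@id L).
Proof.
exists \bot; split => [x|]; first by rewrite joinx0.
by exists \top; split => //; split=> // x; exists x.
Qed.

Lemma is_linear_zero : is_linear (fun _ : L => \bot : L).
Proof.
exists \top; split=> //; exists \bot; split; last 2 first.
- by move=> x y _ _; rewrite meetxx.
- by move=> x y _ _; rewrite joinxx.
split.
- by move=> x _; rewrite itvccE lexx.
- by move=> x y; rewrite !mem_itvcc !lex1 !andbT !le1x
    => /eqP-> /eqP->.
- move=> x; rewrite itvccE le0x /= lex0 => /eqP->.
  by exists \top; rewrite ?itvccE ?lexx.
Qed.

Definition lin_id := LinEnd (asboolT is_linear_id).
Definition lin_zero := LinEnd (asboolT is_linear_zero).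

(* The function f, as a linear morphism, belongs to m. *)
Definition fun_in (m : {pred lin_end}) (f : L -> L) :=
  exists2 phi : lin_end, phi \in m & phi = f :> (L -> L).

(* 'pinv_(fun=> \bot) A phi inverts the restriction of phi to A; it is only
   applied to elements of [\bot, y], the image of [\bot, x] under phi. *)
Definition closed_under_complements (m : {pred lin_end}) :=
  forall phi : lin_end, phi \in m -> forall x y y' : L,
    has_complement x -> is_complement y y' ->
    lattice_iso (itvcc \bot x) (itvcc \bot y) phi ->
    fun_in m (fun a =>
      'pinv_(fun=> \bot) (itvcc \bot x) phi (proj y y' a)).

Definition K_extending (m : {pred lin_end}) :=
  forall phi : lin_end, phi \in m ->
    exists2 c : L, has_complement c & essential_in c (ker phi).

Definition C2 (m : {pred lin_end}) :=
  forall (a x x' : L) (theta : L -> L), is_complement x x' ->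
    lattice_iso (itvcc \bot x) (itvcc \bot a) theta ->
    fun_in m (fun b => theta (proj x x' b)) ->
    has_complement a.

Definition eq_Delta (f g : L -> L) :=
  exists2 x : L, essential x & forall y, y <= x -> f y = g y.

End LinearEndomorphisms.

Section EndMonoid.
Context (d : Order.disp_t) (L : tbModularLatticeType d).

Lemma modularR (x y z : L) : x <= z -> z `&` (y `|` x) = (z `&` y) `|` x.
Proof.
by move=> xz; rewrite meetC (joinC y) -modularL // joinC (meetC y).
Qed.

Lemma is_linear_comp (g f : L -> L) :
  is_linear g -> is_linear f -> is_linear (g \o f).
Proof.
move=> [kg Hg] [kf Hf].
have [k kfk fk] := kernel_surj Hf (leIr (f \top) kg).
have gk : g (kg `&` f \top) = \bot.
  by apply/eqP; rewrite -lex0 -(kernel0 Hg) (kernel_mono Hg) // leIl.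
have gfU x y : g (f (x `|` y)) = g (f x) `|` g (f y).
  by rewrite (kernelU Hf) (kernelU Hg).
have absorb x : k <= x -> f \top `&` (f x `|` kg) = f x.
  move=> kx; rewrite (joinC (f x)) modularR ?(kernel_mono Hf) ?lex1 //.
  by rewrite meetC -fk; apply/join_idPr; exact: kernel_mono Hf _ _ kx.
exists k; split=> [x /=|]; first by rewrite gfU fk gk joinx0.
exists (g (f \top)); split; last by move=> x y _ _; apply: gfU.
  split.
  - move=> x _; rewrite itvccE le0x /=.
    by apply: (kernel_mono Hg); apply: (kernel_mono Hf); apply: lex1.
  - move=> x y; rewrite !mem_itvcc => /andP[kx _] /andP[ky _] gfxy.
    apply: (kernel_inj Hf); rewrite ?(le_trans kfk) //.
    rewrite -(absorb x) // -(absorb y) //; congr (_ `&` _).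
    apply: (kernel_inj Hg); rewrite ?leUr //.
    by rewrite -!(is_kernelE Hg).
  - move=> z; rewrite itvccE le0x /= => zt.
    have [u kgu guz] := kernel_surj Hg
      (le_trans zt (kernel_mono Hg (lex1 (f \top)))).
    have [x kfx fx] := kernel_surj Hf (leIr (f \top) u).
    exists x.
      rewrite itvccE lex1 andbT; apply: (kernel_le Hf) => //.
      by rewrite fk fx leI2.
    rewrite /= fx (is_kernelE Hg) -modularR //.
    have gU : u <= f \top `|` kg.
      apply: (kernel_le Hg); first exact: leUr.
      by rewrite guz -(is_kernelE Hg).
    by rewrite (meet_idPl gU).
move=> x y; rewrite !mem_itvcc => /andP[kx _] /andP[ky _].
rewrite /= (kernelI Hf) ?(le_trans kfk) //.
rewrite (is_kernelE Hg) (is_kernelE Hg (f x)) (is_kernelE Hg (f y)).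
rewrite -(kernelI Hg) ?leUr //; congr g.
rewrite modularR ?leUr //; congr (_ `|` _).
have fyt : f y <= f \top by apply: (kernel_mono Hf); apply: lex1.
by rewrite -{2}(meet_idPl fyt) (meetC (f y)) meetA (meetC _ (f \top)) absorb.
Qed.

Definition lin_comp (g f : lin_end L) : lin_end L :=
  LinEnd (asboolT (is_linear_comp (lin_endP g) (lin_endP f))).

Lemma lin_compA : associative lin_comp.
Proof. by move=> h g f; apply: val_inj. Qed.

Lemma lin_comp1l : left_id (lin_id L) lin_comp.
Proof. by move=> f; apply: val_inj. Qed.

Lemma lin_comp1r : right_id (lin_id L) lin_comp.
Proof. by move=> f; apply: val_inj. Qed.

HB.instance Definition _ :=
  isMonoid.Build (lin_end L) lin_compA lin_comp1l lin_comp1r.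

Lemma essential_preim (f : L -> L) (x : L) : is_linear f -> essential x ->
  exists2 y, essential y & forall t, t <= y -> f t <= x.
Proof.
move=> [k fk] ex; have [y ky fy] := kernel_surj fk (leIr (f \top) x).
exists y; last first.
  by move=> t ty; rewrite (le_trans (kernel_mono fk ty)) // fy leIl.
move=> z yz0; have fxz : x `&` f z = \bot.
  have ft : f z <= f \top by apply: (kernel_mono fk); apply: lex1.
  rewrite -(meet_idPl ft) (meetC (f z)) meetA -fy (is_kernelE fk z).
  rewrite -(kernelI fk) ?leUr //.
  by rewrite modularR // yz0 join0x (kernel0 fk).
have zy : z <= y.
  by apply: (kernel_le fk) => //; rewrite (ex _ fxz) le0x.
by rewrite -yz0; apply/esym/meet_idPr.
Qed.

Lemma essentialI (x y : L) : essential x -> essential y -> essential (x `&` y).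
Proof. by move=> ex ey z; rewrite -meetA => /ex /ey. Qed.

End EndMonoid.

(* The structure umagmaClosed over a monoid is that of its submonoids. *)
Section Quotient.
Context (d : Order.disp_t) (L : tbModularLatticeType d).
Variable m : umagmaClosed (lin_end L).

Definition submonoid : Type := {phi : lin_end L | phi \in m}.

Lemma submonoid_closed : monoid_closed (fun phi => phi \in m).
Proof. by split=> [|f g fm gm]; [exact: gpred1 | exact: gpredM]. Qed.

HB.instance Definition _ := SubChoice.on submonoid.
HB.instance Definition _ :=
  SubChoice_isSubMonoid.Build (lin_end L) (fun phi => phi \in m) submonoid
    submonoid_closed.

Definition Delta (phi psi : submonoid) : bool :=
  `[< eq_Delta (val phi) (val psi) >].

Lemma Delta_refl : reflexive Delta.
Proof.
by move=> f; apply/asboolP; exists \top => // y; rewrite meet1x.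
Qed.

Lemma Delta_sym : symmetric Delta.
Proof.
by move=> f g; apply/asboolP/asboolP => -[x ex fg]; exists x => // y yx;
  rewrite fg.
Qed.

Lemma Delta_trans : transitive Delta.
Proof.
move=> g f h /asboolP[x ex fg] /asboolP[y ey gh]; apply/asboolP.
exists (x `&` y); first exact: essentialI.
by move=> t; rewrite lexI => /andP[tx ty]; rewrite fg // gh.
Qed.

Canonical Delta_equiv := EquivRel Delta Delta_refl Delta_sym Delta_trans.

Lemma Delta_mul (f f' g g' : submonoid) :
  Delta f f' -> Delta g g' -> Delta (f * g)%g (f' * g')%g.
Proof.
move=> /asboolP[x ex ff'] /asboolP[y ey gg']; apply/asboolP.
have [z ez gz] := essential_preim (lin_endP (val g)) ex.
exists (y `&` z); first exact: essentialI.
move=> t; rewrite lexI => /andP[ty tz] /=.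
by rewrite ff' ?gz // gg'.
Qed.

Definition quotient_Delta : Type := {eq_quot Delta_equiv}%qT.

Local Notation class := (\pi_(quotient_Delta)%qT).

HB.instance Definition _ := EqQuotient.on quotient_Delta.
HB.instance Definition _ := Choice.on quotient_Delta.

Lemma classP (f g : submonoid) : reflect (class f = class g) (Delta f g).
Proof. by rewrite -[Delta f g](eqquotE quotient_Delta); apply: eqP. Qed.

Definition quot_one : quotient_Delta := class 1%g.
Definition quot_mul (a b : quotient_Delta) : quotient_Delta :=
  class (repr a * repr b)%g.

Lemma quot_mulE (f g : submonoid) :
  quot_mul (class f) (class g) = class (f * g)%g.
Proof.
by apply/classP/Delta_mul; apply/classP; rewrite reprK.
Qed.

Lemma class_surj (a : quotient_Delta) : exists f, class f = a.
Proof. by exists (repr a); rewrite reprK. Qed.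

Lemma quot_mulA : associative quot_mul.
Proof.
move=> a b c; have [f <-] := class_surj a; have [g <-] := class_surj b.
by have [h <-] := class_surj c; rewrite !quot_mulE mulgA.
Qed.

Lemma quot_mul1l : left_id quot_one quot_mul.
Proof. by move=> a; have [f <-] := class_surj a; rewrite quot_mulE mul1g. Qed.

Lemma quot_mul1r : right_id quot_one quot_mul.
Proof. by move=> a; have [f <-] := class_surj a; rewrite quot_mulE mulg1. Qed.

HB.instance Definition _ :=
  isMonoid.Build quotient_Delta quot_mulA quot_mul1l quot_mul1r.

End Quotient.

Definition regular_monoid (E : monoidType) :=
  forall e : E, exists f : E, e = (e * f * e)%g.

(* Main.v *)
Require Import Defs.
From mathcomp Require Import all_boot all_order.
From mathcomp Require Import boolp classical_sets functions.

Set Implicit Arguments.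
Unset Strict Implicit.
Unset Printing Implicit Defensive.

Import Order.TTheory.
Local Open Scope order_scope.

(** The quasi-inverse of the class of a morphism [phi] with kernel [k] is built
    by hand.  The extending hypothesis puts [k] as an essential element inside
    some [[0, c]] where [c] has a complement [c'].  Two things follow.

    Since [c'] meets [k] trivially, [phi] is an isomorphism from [[0, c']] onto
    [[0, phi c']] ([kernel_disjoint_iso]).  The projection onto [c'] lies in [m]
    ([proj_in]), hence so does its composite with [phi], and C2 makes [phi c']
    a complement, with complement [a'] say.  Closure under complements then puts
    in [m] the morphism [psi] that projects onto [phi c'] along [a'] and
    goes back to [[0, c']] by the inverse of [phi].

    Since [k] is essential in [[0, c]], the join [c' \/ k] is essential in the
    whole lattice ([essential_join_compl]).  Below this join, [phi] takes its
    values under [phi (c' \/ k) = phi c'], where [psi] is a section of [phi];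
    thus [phi psi phi] and [phi] agree there, which is the desired equality
    modulo Delta. *)

Section ModularLattices.
Context (d : Order.disp_t) (L : tbModularLatticeType d).
Implicit Types a c k t x y : L.

Lemma proj_id x x' t : is_complement x x' -> t <= x -> proj x x' t = t.
Proof.
by case=> xx' _ tx; rewrite /proj -modularL // (meetC x') xx' joinx0.
Qed.

(** Modularity gives: if [y] is disjoint from [c' \/ k], then [k] is disjoint
    from [c' \/ y].  Essentiality of [k] in [[0, c]] therefore kills the
    projection of [y] to [c], so [y <= c'], and such a [y] is under the join
    it is disjoint from. *)
Lemma essential_join_compl c c' k :
  is_complement c c' -> essential_in c k -> essential (c' `|` k).
Proof.
move=> [cc' cUc'] [kc ek] y y0.
have kc' : k `&` c' = \bot by apply/eqP; rewrite -lex0 -cc' leI2.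
have le_c' : (c' `|` k) `&` (y `|` c') <= c'.
  by rewrite modularR ?leUl // y0 join0x.
have pcy : (y `|` c') `&` c = \bot.
  apply: ek; first exact: leIr.
  apply/eqP; rewrite -lex0 -kc' lexI leIl /=.
  apply: le_trans le_c'; rewrite lexI; apply/andP; split.
    by rewrite (le_trans (leIl _ _)) ?leUr.
  by rewrite (le_trans (leIr _ _)) ?leIl.
have yc' : y <= c'.
  have <- : y `|` c' = c'.
    by rewrite -[LHS]meetx1 -cUc' modularR ?leUr // pcy join0x.
  exact: leUl.
by rewrite -[RHS]y0; apply/esym/meet_idPr; rewrite (le_trans yc') ?leUl.
Qed.

(** By modularity [x |-> x \/ k] is an isomorphism from [[0, x]] onto
    [[k, x \/ k]] with inverse the meet with [x], and [f] is an isomorphism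
    on the latter interval. *)
Lemma kernel_disjoint_iso (f : L -> L) k x :
  is_kernel f k -> k `&` x = \bot ->
  lattice_iso (itvcc \bot x) (itvcc \bot (f x)) f.
Proof.
move=> fk kx0.
have retr u : u <= x -> (u `|` k) `&` x = u.
  by move=> ux; rewrite -modularL // kx0 joinx0.
split; [split|..].
- by move=> u; rewrite !itvccE !le0x; apply: (kernel_mono fk).
- move=> u v; rewrite !mem_itvcc !le0x /= => ux vx fuv.
  rewrite -(retr u ux) -(retr v vx); congr (_ `&` _).
  by apply: (kernel_inj fk); rewrite ?leUr // -!(is_kernelE fk).
- move=> z; rewrite itvccE le0x /= => zx.
  have [w kw fw] := kernel_surj fk (le_trans zx (kernel_mono fk (lex1 x))).
  exists (w `&` x); first by rewrite itvccE le0x leIr.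
  rewrite (is_kernelE fk) -modularR // (kernelI fk) ?leUr //.
  by rewrite fw -(is_kernelE fk); apply/meet_idPl.
- move=> u v; rewrite !mem_itvcc !le0x /= => ux vx.
  rewrite (is_kernelE fk u) (is_kernelE fk v) -(kernelI fk) ?leUr //.
  rewrite modularR ?leUr // -(is_kernelE fk).
  by rewrite -{2}(meet_idPl vx) (meetC v) meetA retr.
- by move=> u v _ _; apply: (kernelU fk).
Qed.

Variable m : umagmaClosed (lin_end L).

Lemma fun_in_comp (f g : L -> L) :
  fun_in m f -> fun_in m g -> fun_in m (fun x => g (f x)).
Proof.
by move=> [phi phim <-] [psi psim <-]; exists (psi * phi)%g => //; apply: gpredM.
Qed.

(** This is closure under complements for the identity morphism, which
    restricts to the identity of [[0, x]]. *)
Lemma proj_in x x' : closed_under_complements m -> is_complement x x' ->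
  fun_in m (proj x x').
Proof.
move=> mC xx'; have id_iso : lattice_iso (itvcc \bot x) (itvcc \bot x) (@id L).
  by split=> //; split=> // y; exists y.
have [||psi psim psiE] := mC (lin_id L) _ x x x' _ xx' id_iso.
- exact: gpred1.
- by exists x'.
exists psi => //; rewrite psiE; apply/funext => a.
by rewrite [LHS](@pinvKV _ _ _ _ id) // mem_itvcc le0x leIr.
Qed.

(** The kernel being essential in [[0, c]], a complement [c'] of [c] is large
    enough for the inverse of [phi] on [[0, phi c']] to recover [phi], not
    on all of [L], but below the essential element [c' \/ ker phi]. *)
Lemma quasi_inverse_mod_Delta (phi : lin_end L) :
  closed_under_complements m -> K_extending m -> C2 m -> phi \in m ->
  exists2 psi, psi \in m & eq_Delta phi (phi * psi * phi)%g.
Proof.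
move=> mC mK mC2 phim; have [c [c' cc'] kc] := mK _ phim.
have fk := kerP phi; set k := ker phi in kc fk.
have c'c : is_complement c' c.
  by case: cc' => h1 h2; split; rewrite 1?meetC 1?joinC.
have kc'0 : k `&` c' = \bot.
  by case: cc' kc => cc'0 _ [kc _]; apply/eqP; rewrite -lex0 -cc'0 leI2.
have phi_iso := kernel_disjoint_iso fk kc'0.
have [a' aa'] : has_complement (phi c').
  apply: (mC2 _ _ _ _ c'c phi_iso); apply: fun_in_comp (proj_in mC c'c) _.
  by exists phi.
have [|psi psim psiE] := mC _ phim _ _ _ _ aa' phi_iso; first by exists c.
exists psi => //; exists (c' `|` k); first exact: essential_join_compl cc' kc.
move=> t tk; have ta : phi t <= phi c'.
  by rewrite (is_kernelE fk c') (kernel_mono fk tk).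
rewrite /= psiE proj_id //; case: phi_iso => -[_ _ phi_surj] _ _.
by rewrite (surjpK _ phi_surj) // mem_itvcc le0x.
Qed.

End ModularLattices.

Theorem theorem4p15 (d : Order.disp_t) (L : completeModularLatticeType d)
    (m : umagmaClosed (lin_end L)) (m0 : lin_zero L \in m)
    (m_compl : closed_under_complements m)
    (m_ext : K_extending m) (m_C2 : C2 m) :
  regular_monoid (quotient_Delta m).
Proof.
move=> e; have [[phi phim] <-] := class_surj e.
have [psi psim Dphi] := quasi_inverse_mod_Delta m_compl m_ext m_C2 phim.
pose psi' : submonoid m := exist _ psi psim.
exists (\pi_(quotient_Delta m)%qT psi').
rewrite -[RHS]/(quot_mul (quot_mul _ _) _) !quot_mulE.
by apply/classP/asboolP.
Qed.
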